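(* Equip $K\hat N^\infty_*=\bigoplus_{n\ge1}K\hat N^n$ with the bilinear operations defined on names $\vec v,\vec w$ of degree $\ge1$ by $\vec v\prec\vec w:=\vec v_l\vee(\vec v_r\star\vec w)$ and $\vec v\succ\vec w:=(\vec v\star\vec w_l)\vee\vec w_r$. Then $(K\hat N^\infty_*,\prec,\succ)$ is a dendriform dialgebra with $\prec+\succ=\star$, and it is generated by $(1)$. Moreover, on $K\hat N^\infty=K()\oplus K\hat N^\infty_*$, setting $\vec v\prec():=\vec v=:()\succ\vec v$ and $\vec v\succ():=0=:()\prec\vec v$ for $\vec v\neq()$ (with $()\prec()$, $()\succ()$ undefined and $()\star()=()$), the dendriform axioms continue to hold whenever all terms are defined, and $\vec v\star()=()\star\vec v=\vec v$ for all $\vec v$.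
   Context: $K$ is a field of characteristic zero. $\hat N^0=\{()\}$ and for $n\ge1$, $\hat N^n$ is the set of names of planar rooted binary trees with $n$ internal vertices; every element of $\hat N^n$, $n\ge1$, is uniquely $\vec v_l\vee\vec v_r:=(\vec v_l,1,p+1+\vec v_r)$ with $\vec v_l\in\hat N^p,\vec v_r\in\hat N^q$, $p+q+1=n$, where $k+(w_1,\dots,w_q)=(w_1+k,\dots,w_q+k)$; $\vee$ is extended bilinearly. For $\vec v\in\hat N^n,\vec w\in\hat N^m$: $\vec v\nearrow\vec w=(\vec v,n\triangleright w_1,\dots,n\triangleright w_m)$ with $n\triangleright a=a+n$ for $a\neq1$, $n\triangleright1=1$; $\vec v\nwarrow\vec w=(\vec v,n+\vec w)$. $\vec v\star\vec w$ is the sum of all $\vec t\in\hat N^{n+m}$ with $\vec v\nearrow\vec w\le\vec t\le\vec v\nwarrow\vec w$ (componentwise order), extended bilinearly, with $()\star\vec v=\vec v\star()=\vec v$. A dendriform dialgebra is a vector space $E$ with bilinear operations $\prec,\succ$ such that, with $x\star y:=x\prec y+x\succ y$: $(x\prec y)\prec z=x\prec(y\star z)$, $(x\succ y)\prec z=x\succ(y\prec z)$, $(x\star y)\succ z=x\succ(y\succ z)$ for all $x,y,z$. *)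

(* Defs.v *)
From HB Require Import structures.
From mathcomp Require Import all_boot all_order all_algebra.
From mathcomp Require Import finmap.
From mathcomp Require Import monalg.

Set Implicit Arguments.
Unset Strict Implicit.
Unset Printing Implicit Defensive.

Import GRing.Theory.
Local Open Scope ring_scope.

(* Names of planar rooted binary trees: sequences of naturals.         *)

Definition vee (vl vr : seq nat) : seq nat :=
  vl ++ 1%N :: map (addn (size vl).+1) vr.

(* names_f fuel n : the list of names in \hat N^n (fuel >= n) built by  *)
(* the recursive definition \hat N^0 = {()} and                       *)
(* \hat N^n = { vl \vee vr | vl in \hat N^p, vr in \hat N^q, p+q+1=n }. *)
Fixpoint names_f (fuel n : nat) : seq (seq nat) :=
  match fuel with
  | 0 => if n == 0%N then [:: [::]] else [::]
  | f.+1 =>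
    if n is n'.+1 then
      flatten [seq [seq vee vl vr | vl <- names_f f p, vr <- names_f f (n' - p)]
              | p <- iota 0 n]
    else [:: [::]]
  end.

Definition names (n : nat) : seq (seq nat) := names_f n n.

(* v is a name (of some degree; the degree of a name is its length) *)
Definition is_name (v : seq nat) : bool := v \in names (size v).

Definition name_pairs (n : nat) : seq (seq nat * seq nat) :=
  flatten [seq [seq (vl, vr) | vl <- names p, vr <- names (n.-1 - p)]
          | p <- iota 0 n].

(* The (unique) decomposition v = vl \vee vr of a name v of degree >= 1. *)
Definition dec (v : seq nat) : seq nat * seq nat :=
  nth ([::], [::]) (name_pairs (size v))
      (find (fun pr => vee pr.1 pr.2 == v) (name_pairs (size v))).
Definition vl_of v := (dec v).1.
Definition vr_of v := (dec v).2.

Definition tri (n a : nat) : nat := if a == 1%N then 1%N else (a + n)%N.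

Definition nearrow (v w : seq nat) : seq nat := v ++ map (tri (size v)) w.
Definition nwarrow (v w : seq nat) : seq nat := v ++ map (addn (size v)) w.

Definition leseq (s t : seq nat) : bool := all2 leq s t.

(* The free K-vector space on sequences; K \hat N^\infty is the span of *)
(* names inside it.                                                    *)

Section Alg.
Variable K : fieldType.

Definition V := {malg K[seq nat]}.

Definition inN (x : V) : Prop := forall t, t \in msupp x -> is_name t.
Definition inNstar (x : V) : Prop :=
  forall t, t \in msupp x -> is_name t /\ t <> [::].

Definition bilin (f : seq nat -> seq nat -> V) (x y : V) : V :=
  \sum_(v <- msupp x) \sum_(w <- msupp y) (x@_v * y@_w) *: f v w.

Definition veeL (x y : V) : V := bilin (fun a b => << vee a b >>) x y.

Definition star_b (v w : seq nat) : V :=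
  if v == [::] then << w >>
  else if w == [::] then << v >>
  else \sum_(t <- undup (names (size v + size w))
            | leseq (nearrow v w) t && leseq t (nwarrow v w)) << t >>.

Definition star (x y : V) : V := bilin star_b x y.

Definition prec_b (v w : seq nat) : V := veeL << vl_of v >> (star_b (vr_of v) w).
Definition succ_b (v w : seq nat) : V := veeL (star_b v (vl_of w)) << vr_of w >>.

Definition prec (x y : V) : V := bilin prec_b x y.
Definition succ (x y : V) : V := bilin succ_b x y.

(* () < () and () > () undefined.                                      *)
Definition prec_e_b (v w : seq nat) : V :=
  if v == [::] then 0 else if w == [::] then << v >> else prec_b v w.
Definition succ_e_b (v w : seq nat) : V :=
  if w == [::] then 0 else if v == [::] then << w >> else succ_b v w.

(* The bilinear extension is defined iff no pair ((),()) is involved. *)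
Definition undef_pair (x y : V) : bool :=
  ([::] \in msupp x) && ([::] \in msupp y).

Definition precP (x y : V) : option V :=
  if undef_pair x y then None else Some (bilin prec_e_b x y).
Definition succP (x y : V) : option V :=
  if undef_pair x y then None else Some (bilin succ_e_b x y).

Definition eq_if_def (a b : option V) : Prop :=
  match a, b with Some u, Some v => u = v | _, _ => True end.

Definition dendriform_on (E : V -> Prop) (pr su : V -> V -> V) : Prop :=
  (forall x y, E x -> E y -> E (pr x y) /\ E (su x y)) /\
  (forall x y z, E x -> E y -> E z ->
     let st a b := pr a b + su a b in
     [/\ pr (pr x y) z = pr x (st y z),
         pr (su x y) z = su x (pr y z) &
         su (st x y) z = su x (su y z)]).

Definition generated_by (E : V -> Prop) (g : V) (pr su : V -> V -> V) : Prop :=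
  forall P : V -> Prop,
    P g -> P 0 ->
    (forall (a : K) x y, P x -> P y -> P (a *: x + y)) ->
    (forall x y, P x -> P y -> P (pr x y) /\ P (su x y)) ->
    forall x, E x -> P x.

End Alg.

(* Main.v *)
(** Both operations on the interval [v / w, v \ w] are controlled by the root of a
    tree: for v = a \vee b and w = c \vee d, a name t in the interval has its
    root either where v has its root, and then t = a \vee s with s in the interval of
    (b, w), or where w has its root, and then t = s \vee d with s in the interval
    of (v, c). Summing the two cases gives v * w = v < w + v > w. Each dendriform
    axiom for names reduces to an associativity of * in smaller degree, the middle
    one needing none, and their sum is the associativity of *. For generation,
    a \vee b = a > ((1) < b). The axioms involving () hold even with () < () and
    () > () read as 0. *)
Require Import Defs.
From HB Require Import structures.
From mathcomp Require Import all_boot all_order all_algebra.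
From mathcomp Require Import finmap.
From mathcomp Require Import monalg.
From mathcomp Require Import zify.

Section Names.
Set Implicit Arguments.
Unset Strict Implicit.
Unset Printing Implicit Defensive.
Implicit Types a b c d s t v w : seq nat.

(** * Names as trees: entries, induction and unique decomposition *)

Lemma size_vee a b : size (vee a b) = (size a + size b).+1.
Proof. by rewrite size_cat /= size_map addnS. Qed.

Lemma nth_veel a b i : i < size a -> nth 0 (vee a b) i = nth 0 a i.
Proof. by move=> lt_i; rewrite nth_cat lt_i. Qed.

Lemma nth_vee_root a b : nth 0 (vee a b) (size a) = 1.
Proof. by rewrite nth_cat ltnn subnn. Qed.

Lemma nth_veer a b j :
  j < size b -> nth 0 (vee a b) ((size a).+1 + j) = (size a).+1 + nth 0 b j.
Proof.
move=> lt_j; rewrite nth_cat ifF; last by lia.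
have -> : (size a).+1 + j - size a = j.+1 by lia.
by rewrite /= (nth_map 0).
Qed.

Lemma names_fS f n :
  names_f f.+1 n.+1 =
  flatten [seq [seq vee a b | a <- names_f f p, b <- names_f f (n - p)]
          | p <- iota 0 n.+1].
Proof. by []. Qed.

(** Subtrees are enumerated with the fuel left over by the whole tree, while [names] gives degree
    [n] the fuel [n]; this matches the two. *)
Lemma names_f_fuel f g n : n <= f -> n <= g -> names_f f n = names_f g n.
Proof.
elim: f g n => [|f IHf] [|g] [|n] // le_nf le_ng; rewrite !names_fS.
apply/(congr1 flatten)/eq_in_map => p; rewrite mem_iota => lt_p.
by rewrite (IHf g p) ?(IHf g (n - p)) //; lia.
Qed.

Lemma mem_namesS n v :
  v \in names n.+1 ->
  exists a b p, [/\ p <= n, a \in names p, b \in names (n - p) & v = vee a b].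
Proof.
rewrite /names names_fS => /flatten_mapP[p]; rewrite mem_iota => lt_p.
move=> /allpairsPdep[a [b [a_p b_q ->]]]; exists a, b, p.
by rewrite -!(@names_f_fuel n) //; lia.
Qed.

Lemma size_names n v : v \in names n -> size v = n.
Proof.
elim/ltn_ind: n v => -[|n] IHn v; first by rewrite inE => /eqP->.
move=> /mem_namesS[a [b [p [le_p /IHn sa /IHn sb ->]]]].
by rewrite size_vee sa ?sb; lia.
Qed.

Lemma mem_names n v : (v \in names n) = is_name v && (size v == n).
Proof.
apply/idP/andP => [v_n | [v_v /eqP <-]] //.
by rewrite /is_name (size_names v_n).
Qed.

Lemma is_name_vee a b : is_name a -> is_name b -> is_name (vee a b).
Proof.
rewrite /is_name size_vee => na nb; rewrite /names names_fS.
apply/flatten_mapP; exists (size a); first by rewrite mem_iota; lia.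
apply/allpairsPdep; exists a, b; split => //.
  by rewrite (@names_f_fuel _ (size a)) //; lia.
by rewrite addKn (@names_f_fuel _ (size b)) //; lia.
Qed.

Lemma name_case v : is_name v ->
  v = [::] \/ exists a b, [/\ is_name a, is_name b & v = vee a b].
Proof.
case: v => [|x v] nv; [by left | right].
have [a [b [p [_ a_p b_q ->]]]] := mem_namesS nv.
by exists a, b; move: a_p b_q; rewrite !mem_names => /andP[-> _] /andP[-> _].
Qed.

Lemma name_ind (P : seq nat -> Prop) :
    P [::] ->
    (forall a b, is_name a -> is_name b -> P a -> P b -> P (vee a b)) ->
  forall v, is_name v -> P v.
Proof.
move=> P0 Pvee v; elim/ltn_ind: (size v) {-2}v (erefl (size v)) => n IHn {}v sv.
case/name_case => [-> // | [a [b [na nb def_v]]]].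
move: sv; rewrite def_v size_vee => sv.
by apply: Pvee => //; [apply: (IHn (size a)) | apply: (IHn (size b))] => //; lia.
Qed.

(** Positivity makes every entry to the right of a root at least 2, so the root is the last entry
    equal to 1. *)
Lemma name_gt0 v i : is_name v -> i < size v -> 0 < nth 0 v i.
Proof.
move=> nv; elim/name_ind: v / nv i => // a b _ _ IHa IHb i.
rewrite size_vee => lt_i.
case: (ltngtP i (size a)) => [lt_ia | lt_ai | ->].
- by rewrite nth_veel // IHa.
- by rewrite -(subnKC lt_ai) nth_veer; lia.
- by rewrite nth_vee_root.
Qed.

(** Since the root is the last entry equal to 1, equal names have equal root positions, and cutting
    there recovers both subtrees. *)
Lemma vee_inj a b c d : is_name b -> is_name d ->
  vee a b = vee c d -> a = c /\ b = d.
Proof.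
have root_le a' b' c' d' : is_name b' -> vee a' b' = vee c' d' ->
  size c' <= size a'.
  move=> nb eq_v; rewrite leqNgt; apply/negP => lt_ac.
  have := congr1 size eq_v; rewrite !size_vee => eq_s.
  have := nth_vee_root c' d'; rewrite -eq_v -(subnKC lt_ac) nth_veer; last by lia.
  have := @name_gt0 b' (size c' - (size a').+1) nb; lia.
move=> nb nd eq_v; have eq_s : size a = size c.
  apply/eqP; rewrite eqn_leq (root_le _ _ _ _ nb eq_v).
  by rewrite (root_le _ _ _ _ nd (esym eq_v)).
move/eqP: eq_v; rewrite /vee eqseq_cat // => /andP[/eqP-> /eqP[]].
by move=> /(inj_map (@addnI _))->.
Qed.

(** The search in [dec] succeeds because [(a, b)] is listed, so the default of [nth] is not reached;
    by [vee_inj] the pair found can only be [(a, b)]. *)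
Lemma dec_vee a b : is_name a -> is_name b -> dec (vee a b) = (a, b).
Proof.
move=> na nb; rewrite /dec; set s := name_pairs _.
have sP p : p \in s -> is_name p.2.
  move=> /flatten_mapP[k _ /allpairsPdep[c [d [_ + ->]]]].
  by rewrite mem_names => /andP[].
have ab_s : (a, b) \in s.
  rewrite /s size_vee; apply/flatten_mapP; exists (size a).
    by rewrite mem_iota; lia.
  by apply/allpairsPdep; exists a, b; rewrite /= addKn.
have has_s : has (fun p => vee p.1 p.2 == vee a b) s.
  by apply/hasP; exists (a, b) => /=.
have := nth_find ([::], [::]) has_s.
set p := nth _ _ _ => /eqP/vee_inj[] //; last by case: p => c d /= -> ->.
by apply: sP; rewrite mem_nth // -has_find.
Qed.

(** * Intervals between [nearrow] and [nwarrow] *)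

Definition in_interval v w t := leseq (nearrow v w) t && leseq t (nwarrow v w).

Lemma leseqP s t :
  reflect (size s = size t /\ forall i, i < size s -> nth 0 s i <= nth 0 t i)
          (leseq s t).
Proof.
elim: s t => [|x s IHs] [|y t]; try by constructor => //; case.
apply: (iffP andP) => [[le_xy /IHs[eq_s le_st]] | [[eq_s] le_st]].
  by split=> [|[|i]] //=; [rewrite eq_s | apply: le_st].
by split; [exact: (le_st 0) | apply/IHs; split => // i; apply: (le_st i.+1)].
Qed.

(** Both bounds begin with [v], hence so does [t]; only its last [size w] entries can vary. *)
Lemma in_intervalP v w t :
  reflect [/\ size t = size v + size w,
              forall i, i < size v -> nth 0 t i = nth 0 v i &
              forall j, j < size w ->
                tri (size v) (nth 0 w j) <= nth 0 t (size v + j)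
                  <= size v + nth 0 w j]
          (in_interval v w t).
Proof.
have ne i : i < size v -> nth 0 (nearrow v w) i = nth 0 v i.
  by move=> lt_i; rewrite nth_cat lt_i.
have nw i : i < size v -> nth 0 (nwarrow v w) i = nth 0 v i.
  by move=> lt_i; rewrite nth_cat lt_i.
have ne' j : j < size w ->
    nth 0 (nearrow v w) (size v + j) = tri (size v) (nth 0 w j).
  by move=> lt_j; rewrite nth_cat ifF ?addKn ?(nth_map 0) //; lia.
have nw' j : j < size w ->
    nth 0 (nwarrow v w) (size v + j) = size v + nth 0 w j.
  by move=> lt_j; rewrite nth_cat ifF ?addKn ?(nth_map 0) //; lia.
have s_ne : size (nearrow v w) = size v + size w by rewrite size_cat size_map.
have s_nw : size (nwarrow v w) = size v + size w by rewrite size_cat size_map.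
apply: (iffP andP) => [[/leseqP[s1 le1] /leseqP[s2 le2]] | [st tv tw]].
  split=> [|i lt_i|j lt_j]; first by rewrite -s1.
    have := le1 i; have := le2 i; rewrite ne ?nw //; lia.
  have := le1 (size v + j); have := le2 (size v + j); rewrite ne' ?nw' //; lia.
split; apply/leseqP; split; rewrite ?s_ne ?s_nw ?st // => i lt_i.
  have [lt_iv | le_vi] := ltnP i (size v); first by rewrite ne ?tv.
  rewrite -(subnKC le_vi) ne'; last by lia.
  by case/andP: (tw (i - size v) ltac:(lia)).
have [lt_iv | le_vi] := ltnP i (size v); first by rewrite nw ?tv.
rewrite -(subnKC le_vi) nw'; last by lia.
by case/andP: (tw (i - size v) ltac:(lia)).
Qed.

(* [t] has entry 1 at its root and entries beyond the root that exceed the root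
   position; on the interval this leaves only the roots of [vee a b] and of
   [vee c d] as possible roots of [t]. *)
Lemma root_in_interval a b c d tl tr :
    is_name b -> is_name d -> is_name tr ->
    in_interval (vee a b) (vee c d) (vee tl tr) ->
  size tl = size a \/ size tl = size (vee a b) + size c.
Proof.
move=> nb nd ntr /in_intervalP[]; set t := vee tl tr; rewrite !size_vee => st tv tw.
have st' : size t = (size tl + size tr).+1 := size_vee tl tr.
have t_gt i : size tl < i -> i < size t -> (size tl).+1 < nth 0 t i.
  move=> lt_i lt_it; rewrite -(subnKC lt_i) nth_veer; last by lia.
  by have := @name_gt0 tr (i - (size tl).+1) ntr; lia.
have t_root : nth 0 t (size tl) = 1 by rewrite nth_vee_root.
have t_a : nth 0 t (size a) = 1 by rewrite tv ?nth_vee_root //; lia.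
have t_b i : size a < i -> i < (size a + size b).+1 -> 1 < nth 0 t i.
  move=> lt_ai lt_i; rewrite tv // -(subnKC lt_ai) nth_veer; last by lia.
  by have := @name_gt0 b (i - (size a).+1) nb; lia.
have /andP[_ t_c] := tw (size c) ltac:(lia); rewrite nth_vee_root in t_c.
have t_d i : (size a + size b).+1 + size c < i -> i < size t -> 1 < nth 0 t i.
  move=> lt_i lt_it; have /andP[+ _] := tw (i - (size a + size b).+1) ltac:(lia).
  have -> : (size a + size b).+1 + (i - (size a + size b).+1) = i by lia.
  have {1}-> : i - (size a + size b).+1 =
    (size c).+1 + (i - ((size a + size b).+1 + size c).+1) by lia.
  rewrite nth_veer; last by lia.
  have := @name_gt0 d (i - ((size a + size b).+1 + size c).+1) nd.
  by rewrite /tri; case: eqP; lia.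
(* A root left of [size a] contradicts [t_gt] at [size a], where the entry is 1. A root further
   right but still inside [vee a b] contradicts [t_b]. A root inside the block of [c] would push the
   entry at the root position of [vee c d] above the bound [t_c], and one beyond that position
   contradicts [t_d]. *)
have := t_gt (size a); have := t_b (size tl); have := t_d (size tl).
have := t_gt ((size a + size b).+1 + size c).
lia.
Qed.

(** Removing [a] and the root shifts all bounds alike, except the lower bound at entries 1 of [w]:
    it is 1 on both sides, and holds there because entries of names are positive. *)
Lemma in_interval_veel a b w s : is_name b -> is_name s ->
  in_interval (vee a b) w (vee a s) = in_interval b w s.
Proof.
move=> nb ns; apply/in_intervalP/in_intervalP; rewrite !size_vee => -[st tv tw].
  split=> [|i lt_i|j lt_j]; first by lia.
    by have := tv ((size a).+1 + i) ltac:(lia); rewrite !nth_veer; lia.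
  have /andP[] := tw j lt_j; have := @name_gt0 s (size b + j) ns ltac:(lia).
  have -> : (size a + size b).+1 + j = (size a).+1 + (size b + j) by lia.
  rewrite nth_veer; last by lia.
  by rewrite /tri; case: eqP; lia.
split=> [|i lt_i|j lt_j]; first by lia.
  case: (ltngtP i (size a)) => [lt_ia | lt_ai | ->].
  - by rewrite !nth_veel.
  - by rewrite -(subnKC lt_ai) !nth_veer ?tv //; lia.
  - by rewrite !nth_vee_root.
have -> : (size a + size b).+1 + j = (size a).+1 + (size b + j) by lia.
rewrite nth_veer; last by lia.
by have /andP[] := tw j lt_j; rewrite /tri; case: eqP; lia.
Qed.

(** The root and the block of [d] impose no condition: the root entry 1 meets its lower bound, and
    beyond it the entries of [vee c d] exceed 1, so both bounds agree there and equal the entries of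
    [vee s d]. *)
Lemma in_interval_veer v c d s : is_name d ->
  in_interval v (vee c d) (vee s d) = in_interval v c s.
Proof.
move=> nd; apply/in_intervalP/in_intervalP; rewrite !size_vee => -[st tv tw].
  have ss : size s = size v + size c by lia.
  split=> // [i lt_i|j lt_j]; first by rewrite -tv // nth_veel //; lia.
  by have := tw j ltac:(lia); rewrite !nth_veel //; lia.
split=> [|i lt_i|j lt_j]; first by lia.
  by rewrite nth_veel ?tv //; lia.
case: (ltngtP j (size c)) => [lt_jc | lt_cj | ->].
- by rewrite !nth_veel; [apply: tw | lia..].
- have [k def_j] : exists k, j = (size c).+1 + k by exists (j - (size c).+1); lia.
  have -> : size v + j = (size s).+1 + k by lia.
  rewrite def_j !nth_veer; try lia.
  by have := @name_gt0 d k nd ltac:(lia); rewrite /tri; case: eqP; lia.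
- by rewrite -st !nth_vee_root /tri /=; lia.
Qed.

(** If the root is that of [vee a b], the left subtree is [a] because [t] begins with [vee a b]. If
    it is that of [vee c d], the right subtree is [d] because the bounds coincide beyond the
    root. *)
Lemma in_interval_vee a b c d t :
    is_name a -> is_name b -> is_name c -> is_name d -> is_name t ->
    in_interval (vee a b) (vee c d) t ->
  (exists2 s, is_name s & t = vee a s) \/ (exists2 s, is_name s & t = vee s d).
Proof.
move=> na nb nc nd nt Dt.
case: (name_case nt) => [t0 | [tl [tr [ntl ntr def_t]]]].
  by case/in_intervalP: Dt; rewrite t0 !size_vee.
rewrite {t nt}def_t in Dt *; have root_t := root_in_interval nb nd ntr Dt.
case/in_intervalP: Dt; rewrite !size_vee in root_t *; move=> st tv tw.
case: root_t => s_tl; [left; exists tr | right; exists tl] => //; congr vee.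
  apply: (@eq_from_nth _ 0) => // i lt_i.
  by rewrite -(@nth_veel tl tr) // tv ?nth_veel //; lia.
apply: (@eq_from_nth _ 0) => [|j lt_j]; first by lia.
have := tw ((size c).+1 + j) ltac:(lia).
have -> : (size a + size b).+1 + ((size c).+1 + j) = (size tl).+1 + j by lia.
rewrite !nth_veer; try lia.
have := @name_gt0 d j nd ltac:(lia); rewrite /tri; case: eqP; lia.
Qed.

(** * Splitting an interval at the root *)

Definition interval v w :=
  [seq t <- undup (names (size v + size w)) | in_interval v w t].

Lemma mem_interval v w t : (t \in interval v w) = is_name t && in_interval v w t.
Proof.
rewrite mem_filter mem_undup mem_names andbC; case: in_intervalP; rewrite ?andbF //.
by case=> -> _ _; rewrite eqxx !andbT.
Qed.

Lemma interval_uniq v w : uniq (interval v w).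
Proof. exact/filter_uniq/undup_uniq. Qed.

Lemma interval_vee a b c d :
    is_name a -> is_name b -> is_name c -> is_name d ->
  perm_eq (interval (vee a b) (vee c d))
    (map (vee a) (interval b (vee c d)) ++
     map (vee^~ d) (interval (vee a b) c)).
Proof.
move=> na nb nc nd; apply: uniq_perm => [||t]; first exact: interval_uniq.
  rewrite cat_uniq !map_inj_in_uniq ?interval_uniq ?andbT /=.
  (* The two halves are disjoint: a common name would give [s = a], but [s] is longer than [a]. *)
  - apply/hasPn => _ /mapP[s + ->].
    rewrite mem_interval => /andP[_ /in_intervalP[ss _ _]].
    apply/mapP => -[s']; rewrite mem_interval => /andP[ns' _] /vee_inj[] // eq_s _.
    by move: ss; rewrite eq_s size_vee; lia.
  - by move=> s s' _ _ /vee_inj[].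
  by move=> s s'; rewrite !mem_interval => /andP[ns _] /andP[ns' _] /vee_inj[].
rewrite mem_interval mem_cat; apply/andP/orP => [[nt Dt] | []].
- have [[s ns def_t] | [s ns def_t]] := in_interval_vee na nb nc nd nt Dt;
    rewrite def_t in Dt *; [left | right];
    apply/mapP; exists s; rewrite ?mem_interval ?ns //=.
    by rewrite -(in_interval_veel a _ nb ns).
  by rewrite -(in_interval_veer _ _ _ nd).
- case/mapP=> s; rewrite mem_interval => /andP[ns Ds] ->.
  by rewrite in_interval_veel ?is_name_vee.
case/mapP=> s; rewrite mem_interval => /andP[ns Ds] ->.
by rewrite in_interval_veer ?is_name_vee.
Qed.

(** The convention of [star_b] for () is no exception to the interval formula: with a factor () on
    either side both bounds coincide. *)
Lemma interval0r v : is_name v -> interval v [::] = [:: v].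
Proof.
move=> nv; apply: perm_small_eq => //.
apply: uniq_perm (interval_uniq _ _) _ _ => // t.
rewrite mem_interval inE; apply/andP/eqP => [[_ /in_intervalP[st tv _]] | ->].
  by rewrite addn0 in st; apply: (@eq_from_nth _ 0) => // i; rewrite st; apply: tv.
by split=> //; apply/in_intervalP; split; rewrite ?addn0.
Qed.

Lemma interval0l w : is_name w -> interval [::] w = [:: w].
Proof.
move=> nw; apply: perm_small_eq => //.
apply: uniq_perm (interval_uniq _ _) _ _ => // t.
have tri0 n : tri 0 n = n by rewrite /tri addn0; case: eqP => // ->.
rewrite mem_interval inE; apply/andP/eqP => [[_ /in_intervalP[st _ tw]] | ->].
  apply: (@eq_from_nth _ 0) => // i; rewrite st => /tw.
  by rewrite tri0 !add0n => /anti_leq.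
by split=> //; apply/in_intervalP; split=> // j _; rewrite tri0 !add0n leqnn.
Qed.

End Names.

Local Open Scope ring_scope.

Section Dendriform.
Set Implicit Arguments.
Unset Strict Implicit.
Unset Printing Implicit Defensive.
Import GRing.Theory.
Variable K : fieldType.
Local Notation V := (V K).
Implicit Types (a b c d u v w t : seq nat) (x y z : V) (k : K).

(** * Linear and bilinear extension from names *)

Lemma malg_basisE x : x = \sum_(v <- msupp x) x@_v *: << v >>.
Proof.
rewrite {1}[x]monalgE; apply: eq_bigr => v _; apply/malgP => w.
by rewrite mcoeffZ !mcoeffU mulrnAr mulr1.
Qed.

Definition supported (D : seq nat -> Prop) x := forall v, v \in msupp x -> D v.

Lemma supported0 D : supported D 0.
Proof. by move=> v; rewrite msupp0. Qed.

Lemma supportedU (D : seq nat -> Prop) v : D v -> supported D << v >>.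
Proof. by move=> Dv w; rewrite msuppU oner_eq0 inE => /eqP->. Qed.

Lemma supportedP D k x y :
  supported D x -> supported D y -> supported D (k *: x + y).
Proof.
move=> Dx Dy v /(fsubsetP (msuppD_le _ _)); rewrite in_fsetU => /orP[|/Dy //].
by move/(fsubsetP (msuppZ_le _ _))/Dx.
Qed.

Lemma supported_sum D (r : seq (seq nat)) (F : seq nat -> V) :
  (forall v, v \in r -> supported D (F v)) -> supported D (\sum_(v <- r) F v).
Proof.
move=> DF; rewrite big_seq.
elim/big_rec: _ => [|v y /DF Dv Dy]; first exact: supported0.
by rewrite -[F v]scale1r; apply: supportedP.
Qed.

Lemma supported_ind (D : seq nat -> Prop) (P : V -> Prop) :
    P 0 -> (forall k x y, P x -> P y -> P (k *: x + y)) ->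
    (forall v, D v -> P << v >>) ->
  forall x, supported D x -> P x.
Proof.
move=> P0 Plin PD x Dx; rewrite [x]malg_basisE big_seq.
by elim/big_rec: _ => // v y /Dx/PD Pv; apply: Plin.
Qed.

Lemma lin0 (f : V -> V) : linear f -> f 0 = 0.
Proof. by move=> /(_ (-1) 0 0); rewrite !scaleN1r oppr0 addr0 addNr. Qed.

Lemma lin_sum (f : V -> V) (r : seq (seq nat)) (F : seq nat -> V) :
  linear f -> f (\sum_(v <- r) F v) = \sum_(v <- r) f (F v).
Proof.
move=> linf; elim: r => [|v r IHr]; first by rewrite !big_nil lin0.
by rewrite !big_cons -[F v]scale1r linf IHr !scale1r.
Qed.

Lemma eq_on_supported D (f g : V -> V) :
    linear f -> linear g -> (forall v, D v -> f << v >> = g << v >>) ->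
  forall x, supported D x -> f x = g x.
Proof.
move=> linf ling; apply: supported_ind => [|k x y fx fy]; first by rewrite !lin0.
by rewrite linf ling fx fy.
Qed.

Section Bilinear.
Implicit Type f : seq nat -> seq nat -> V.

Definition lin_ext (g : seq nat -> V) x := \sum_(v <- msupp x) x@_v *: g v.

Lemma lin_extEw (A : {fset seq nat}) g x :
  (msupp x `<=` A)%fset -> lin_ext g x = \sum_(v <- A) x@_v *: g v.
Proof.
move=> sA; apply: big_fset_incl => // v _ /mcoeff_outdom->.
by rewrite scale0r.
Qed.

(** The three sums run over different supports; all are rewritten over one finite set [A] that
    contains them. *)
Lemma lin_extP g : linear (lin_ext g).
Proof.
move=> k x y; pose A := (msupp x `|` msupp y `|` msupp (k *: x + y))%fset.
have sA : [&& msupp x `<=` A, msupp y `<=` A & msupp (k *: x + y) `<=` A]%fset.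
  by rewrite andbA -!fsubUset.
case/and3P: sA => sx sy sxy; rewrite !(@lin_extEw A) //.
rewrite scaler_sumr -big_split; apply: eq_bigr => v _ /=.
by rewrite mcoeffD mcoeffZ scalerDl scalerA.
Qed.

Lemma bilinE f x y : bilin f x y = lin_ext (fun v => lin_ext (f v) y) x.
Proof.
apply: eq_bigr => v _; rewrite scaler_sumr.
by apply: eq_bigr => w _; rewrite scalerA.
Qed.

Lemma bilinPl f y : linear (fun x => bilin f x y).
Proof. by move=> k x x'; rewrite !bilinE lin_extP. Qed.

Lemma bilinPr f x : linear (bilin f x).
Proof.
move=> k y y'; rewrite !bilinE scaler_sumr -big_split; apply: eq_bigr => v _ /=.
by rewrite lin_extP scalerDr !scalerA mulrC.
Qed.

Lemma bilinU f v w : bilin f << v >> << w >> = f v w.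
Proof.
by rewrite /bilin !msuppU oner_eq0 !big_seq_fset1 !mcoeffUU mulr1 scale1r.
Qed.

Lemma eq_bilin (D E : seq nat -> Prop) f g x y :
    (forall v w, D v -> E w -> f v w = g v w) ->
  supported D x -> supported E y -> bilin f x y = bilin g x y.
Proof.
move=> eq_fg Dx Ey; rewrite /bilin big_seq [RHS]big_seq; apply: eq_bigr => v /Dx Dv.
by rewrite big_seq [RHS]big_seq; apply: eq_bigr => w /Ey Ew; rewrite eq_fg.
Qed.

Lemma supported_bilin (D E G : seq nat -> Prop) f x y :
    (forall v w, D v -> E w -> supported G (f v w)) ->
  supported D x -> supported E y -> supported G (bilin f x y).
Proof.
move=> Gf Dx Ey; apply: supported_sum => v /Dx Dv; apply: supported_sum => w /Ey Ew.
by rewrite -[_ *: _]addr0; apply: supportedP (Gf _ _ Dv Ew) (@supported0 _).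
Qed.

(** Reduces each trilinear axiom to names. Four independent operations and three supports let one
    lemma serve the dendriform axioms, the rules for [veeL] and the extension to (). *)
Lemma bilin_assoc (D E G : seq nat -> Prop) f g f' g' x y z :
    (forall u v w, D u -> E v -> G w ->
       bilin f (bilin g << u >> << v >>) << w >> =
       bilin f' << u >> (bilin g' << v >> << w >>)) ->
    supported D x -> supported E y -> supported G z ->
  bilin f (bilin g x y) z = bilin f' x (bilin g' y z).
Proof.
move=> fgA Dx Ey Gz; move: x Dx.
apply: (@eq_on_supported D (fun x => bilin f (bilin g x y) z)
                           (fun x => bilin f' x (bilin g' y z)))
  => [k x x'|k x x'|u Du].
- by rewrite !bilinPl.
- by rewrite bilinPl.
move: y Ey.
apply: (@eq_on_supported E (fun y => bilin f (bilin g << u >> y) z)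
                           (fun y => bilin f' << u >> (bilin g' y z)))
  => [k y y'|k y y'|v Ev].
- by rewrite bilinPr bilinPl.
- by rewrite bilinPl bilinPr.
move: z Gz.
apply: (@eq_on_supported G (fun z => bilin f (bilin g << u >> << v >>) z)
                           (fun z => bilin f' << u >> (bilin g' << v >> z)))
  => [k z z'|k z z'|w Gw].
- by rewrite bilinPr.
- by rewrite !bilinPr.
exact: fgA.
Qed.

End Bilinear.

(** * The product and its two halves on spans of names *)

Definition nename v := is_name v /\ v <> [::].

Lemma nenameE v : nename v -> exists a b, [/\ is_name a, is_name b & v = vee a b].
Proof. by case=> /name_case[]. Qed.

Lemma nename_vee a b : is_name a -> is_name b -> nename (vee a b).
Proof. by move=> na nb; split; [apply: is_name_vee | case: a {na}]. Qed.

Lemma inNstarN x : inNstar x -> inN x.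
Proof. by move=> Nx v /Nx[]. Qed.

Lemma inNU v : is_name v -> inN (<< v >> : V).
Proof. exact: supportedU. Qed.

Lemma inNstarU v : nename v -> inNstar (<< v >> : V).
Proof. exact: supportedU. Qed.

Lemma star_b0r v : star_b K v [::] = << v >>.
Proof. by rewrite /star_b; case: eqP => // ->. Qed.

Lemma star_b0l w : star_b K [::] w = << w >>.
Proof. by []. Qed.

Lemma star_bE v w : is_name v -> is_name w ->
  star_b K v w = \sum_(t <- interval v w) << t >>.
Proof.
move=> nv nw; rewrite /star_b; case: eqP => [->|_].
  by rewrite interval0l // big_seq1.
case: eqP => [->|_]; first by rewrite interval0r // big_seq1.
by rewrite big_filter.
Qed.

Lemma star0r x : star x << [::] >> = x.
Proof.
apply: (@eq_on_supported xpredT (fun x => star x << [::] >>) id) => // [|v _].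
  exact: bilinPl.
by rewrite /star bilinU star_b0r.
Qed.

Lemma star0l x : star << [::] >> x = x.
Proof.
apply: (@eq_on_supported xpredT (star << [::] >>) id) => // [|v _].
  exact: bilinPr.
by rewrite /star bilinU star_b0l.
Qed.

Lemma prec_b_vee a b w : is_name a -> is_name b ->
  prec_b K (vee a b) w = veeL << a >> (star_b K b w).
Proof. by move=> na nb; rewrite /prec_b /vl_of /vr_of dec_vee. Qed.

Lemma succ_b_vee v c d : is_name c -> is_name d ->
  succ_b K v (vee c d) = veeL (star_b K v c) << d >>.
Proof. by move=> nc nd; rewrite /succ_b /vl_of /vr_of dec_vee. Qed.

Lemma veeLU a b : veeL << a >> << b >> = << vee a b >> :> V.
Proof. exact: bilinU. Qed.

Lemma inN_star_b v w : is_name v -> is_name w -> inN (star_b K v w).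
Proof.
move=> nv nw; rewrite star_bE //; apply: supported_sum => t.
by rewrite mem_interval => /andP[nt _]; apply: inNU.
Qed.

Lemma inN_star x y : inN x -> inN y -> inN (star x y).
Proof. exact: (@supported_bilin is_name is_name is_name) inN_star_b. Qed.

Lemma inNstar_veeL x y : inN x -> inN y -> inNstar (veeL x y).
Proof.
apply: (@supported_bilin is_name is_name nename) => a b na nb.
exact/inNstarU/nename_vee.
Qed.

Lemma inNstar_prec_b v w : nename v -> is_name w -> inNstar (prec_b K v w).
Proof.
move=> /nenameE[a [b [na nb ->]]] nw; rewrite prec_b_vee //.
by apply: inNstar_veeL; [apply: inNU | apply: inN_star_b].
Qed.

Lemma inNstar_succ_b v w : is_name v -> nename w -> inNstar (succ_b K v w).
Proof.
move=> nv /nenameE[c [d [nc nd ->]]]; rewrite succ_b_vee //.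
by apply: inNstar_veeL; [apply: inN_star_b | apply: inNU].
Qed.

Lemma inNstar_prec x y : inNstar x -> inN y -> inNstar (prec x y).
Proof. exact: (@supported_bilin nename is_name nename) inNstar_prec_b. Qed.

Lemma inNstar_succ x y : inN x -> inNstar y -> inNstar (succ x y).
Proof. exact: (@supported_bilin is_name nename nename) inNstar_succ_b. Qed.

(** The defining formula with subtrees replaced by vectors, so that the sums produced by [star] need
    not be expanded in later computations. *)
Lemma prec_veeL x y z : inN x -> inN y -> inN z ->
  prec (veeL x y) z = veeL x (star y z).
Proof. by apply: bilin_assoc => a b w na nb _; rewrite !bilinU prec_b_vee. Qed.

Lemma succ_veeL x y z : inN x -> inN y -> inN z ->
  succ x (veeL y z) = veeL (star x y) z.
Proof.
move=> Nx Ny Nz; apply/esym; move: Nx Ny Nz.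
by apply: bilin_assoc => v c d _ nc nd; rewrite !bilinU succ_b_vee.
Qed.

Lemma prec_vee a b x : is_name a -> is_name b -> inN x ->
  prec << vee a b >> x = veeL << a >> (star << b >> x).
Proof. by move=> na nb Nx; rewrite -prec_veeL ?veeLU //; apply: inNU. Qed.

Lemma succ_vee c d x : is_name c -> is_name d -> inN x ->
  succ x << vee c d >> = veeL (star x << c >>) << d >>.
Proof. by move=> nc nd Nx; rewrite -succ_veeL ?veeLU //; apply: inNU. Qed.

Lemma star_b_prec_succ v w : nename v -> nename w ->
  star_b K v w = prec_b K v w + succ_b K v w.
Proof.
move=> /nenameE[a [b [na nb ->]]] /nenameE[c [d [nc nd ->]]].
rewrite prec_b_vee // succ_b_vee // !star_bE ?is_name_vee //.
(* The two halves of the interval give the two summands, by linearity of [veeL] in its right and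
   left argument. *)
rewrite (perm_big _ (interval_vee na nb nc nd)) big_cat !big_map; congr (_ + _).
  by rewrite lin_sum; [apply: eq_bigr => s _; rewrite veeLU | apply: bilinPr].
rewrite (@lin_sum (fun x => veeL x << d >>)); last exact: bilinPl.
by apply: eq_bigr => s _; rewrite veeLU.
Qed.

Lemma prec_succ x y : inNstar x -> inNstar y -> prec x y + succ x y = star x y.
Proof.
move=> Nx Ny; rewrite /prec /succ /bilin -big_split -/(star x y).
transitivity (bilin (fun v w => prec_b K v w + succ_b K v w) x y).
  apply: eq_bigr => v _; rewrite -big_split; apply: eq_bigr => w _ /=.
  by rewrite scalerDr.
exact/esym/(eq_bilin star_b_prec_succ Nx Ny).
Qed.

Lemma inNstar_star x y : inNstar x -> inNstar y -> inNstar (star x y).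
Proof.
move=> Nx Ny; rewrite -prec_succ // -[prec x y]scale1r; apply: supportedP.
  by apply: inNstar_prec => //; apply: inNstarN.
by apply: inNstar_succ => //; apply: inNstarN.
Qed.

(** * Dendriform axioms and associativity *)

(** For a middle name [vee c d], both sides are [veeL (star u c) (star d w)]. *)
Lemma succ_precA x y z : inN x -> inNstar y -> inN z ->
  prec (succ x y) z = succ x (prec y z).
Proof.
apply: bilin_assoc => u v w nu /nenameE[c [d [nc nd ->]]] nw.
have [Mu Mw] := (inNU nu, inNU nw); have [Mc Md] := (inNU nc, inNU nd).
have [Muc Mdw] := (inN_star Mu Mc, inN_star Md Mw).
change (prec (succ << u >> << vee c d >>) << w >> =
        succ << u >> (prec << vee c d >> << w >>) :> V).
rewrite (succ_vee nc nd Mu) (prec_vee nc nd Mw).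
by rewrite (prec_veeL Muc Md Mw) (succ_veeL Mu Mc Mdw).
Qed.

Lemma precDl x y z : prec (x + y) z = prec x z + prec y z.
Proof. by rewrite -[x]scale1r [LHS]bilinPl !scale1r. Qed.

Lemma succDr x y z : succ x (y + z) = succ x y + succ x z.
Proof. by rewrite -[y]scale1r [LHS]bilinPr !scale1r. Qed.

(** The outer axioms are hypotheses here, so that the lemma can be applied inside the induction that
    proves them. *)
Lemma starA_of_precA_succA x y z : inNstar x -> inNstar y -> inNstar z ->
    prec (prec x y) z = prec x (star y z) ->
    succ (star x y) z = succ x (succ y z) ->
  star (star x y) z = star x (star y z).
Proof.
move=> Nx Ny Nz precA succA.
have [Nxy Nyz] := (inNstar_star Nx Ny, inNstar_star Ny Nz).
rewrite -(prec_succ Nxy Nz) -(prec_succ Nx Nyz) -precA succA.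
rewrite -(prec_succ Nx Ny) -(prec_succ Ny Nz) precDl succDr addrA.
by rewrite [X in _ + X + _ = _](succ_precA (inNstarN Nx) Ny (inNstarN Nz)).
Qed.

(** Induction on the total degree. With [u = vee a b] the first axiom reduces to associativity for
    [b, v, w]; with [w = vee e f] the last reduces to [u, v, e]. *)
Lemma starA_name u v w : is_name u -> is_name v -> is_name w ->
  star (star << u >> << v >>) << w >> = star << u >> (star << v >> << w >>) :> V.
Proof.
have [n] := ubnP (size u + size v + size w)%N.
elim: n u v w => // n IHn u v w; rewrite ltnS => le_n nu nv nw.
have [-> | /eqP u0] := eqVneq u [::]; first by rewrite !star0l.
have [-> | /eqP v0] := eqVneq v [::]; first by rewrite star0l star0r.
have [-> | /eqP w0] := eqVneq w [::]; first by rewrite !star0r.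
have [Nu Nv] := (inNstarU (conj nu u0), inNstarU (conj nv v0)).
have Nw := inNstarU (conj nw w0).
have [[Mu Mv] Mw] := (inNU nu, inNU nv, inNU nw).
have [Muv Mvw] := (inN_star Mu Mv, inN_star Mv Mw).
have precA : prec (prec << u >> << v >>) << w >> =
    prec << u >> (star << v >> << w >>) :> V.
  have [a [b [na nb def_u]]] := nenameE (conj nu u0).
  have [Ma Mb] := (inNU na, inNU nb); have Mbv := inN_star Mb Mv.
  rewrite def_u (prec_vee na nb Mv) (prec_vee na nb Mvw).
  rewrite (prec_veeL Ma Mbv Mw) IHn //.
  by move: le_n; rewrite def_u size_vee; lia.
have succA : succ (star << u >> << v >>) << w >> =
    succ << u >> (succ << v >> << w >>) :> V.
  have [e [f [ne nf def_w]]] := nenameE (conj nw w0).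
  have [Me Mf] := (inNU ne, inNU nf); have Mve := inN_star Mv Me.
  rewrite def_w (succ_vee ne nf Muv) (succ_vee ne nf Mv).
  rewrite (succ_veeL Mu Mve Mf) IHn //.
  by move: le_n; rewrite def_w size_vee; lia.
exact: starA_of_precA_succA.
Qed.

(** With associativity known in all degrees, [y] and [z] may have a component at (); the extension
    to () relies on this. *)
Lemma prec_precA x y z : inNstar x -> inN y -> inN z ->
  prec (prec x y) z = prec x (star y z).
Proof.
apply: bilin_assoc => u v w /nenameE[a [b [na nb ->]]] nv nw.
have [Ma Mb] := (inNU na, inNU nb); have [Mv Mw] := (inNU nv, inNU nw).
have [Mbv Mvw] := (inN_star Mb Mv, inN_star Mv Mw).
change (prec (prec << vee a b >> << v >>) << w >> =
        prec << vee a b >> (star << v >> << w >>) :> V).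
rewrite (prec_vee na nb Mv) (prec_vee na nb Mvw).
by rewrite (prec_veeL Ma Mbv Mw) starA_name.
Qed.

Lemma succ_succA x y z : inN x -> inN y -> inNstar z ->
  succ (star x y) z = succ x (succ y z).
Proof.
apply: bilin_assoc => u v w nu nv /nenameE[c [d [nc nd ->]]].
have [Mc Md] := (inNU nc, inNU nd); have [Mu Mv] := (inNU nu, inNU nv).
have [Mvc Muv] := (inN_star Mv Mc, inN_star Mu Mv).
change (succ (star << u >> << v >>) << vee c d >> =
        succ << u >> (succ << v >> << vee c d >>) :> V).
rewrite (succ_vee nc nd Muv) (succ_vee nc nd Mv).
by rewrite (succ_veeL Mu Mvc Md) starA_name.
Qed.

Lemma dendriform_inNstar : dendriform_on (@inNstar K) (@prec K) (@succ K).
Proof.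
split=> [x y Nx Ny | x y z Nx Ny Nz st].
  by split; [apply: inNstar_prec | apply: inNstar_succ] => //; apply: inNstarN.
have [Mx [My Mz]] := (inNstarN Nx, (inNstarN Ny, inNstarN Nz)).
rewrite /st (prec_succ Nx Ny) (prec_succ Ny Nz); split; first exact: prec_precA.
  exact: succ_precA.
exact: succ_succA.
Qed.

(** * Generation by (1) *)

Lemma generated_inNstar :
  generated_by (@inNstar K) << [:: 1%N] >> (@prec K) (@succ K).
Proof.
move=> P P1 P0 Plin Pop; apply: (@supported_ind nename) => // v [nv].
have [n0 N0] : is_name [::] /\ inN (<< [::] >> : V) by split=> //; apply: inNU.
elim/name_ind: v / nv => // a b na nb IHa IHb _.
(* Since (1) is [vee [::] [::]], this name is (1) itself or the product [prec] of (1) and [b]. *)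
have Prb : P << vee [::] b >>.
  have [-> // | /eqP b0] := eqVneq b [::].
  have [+ _] := Pop _ _ P1 (IHb b0).
  by rewrite -[[:: 1%N]]/(vee [::] [::]) prec_vee ?star0l ?veeLU //; apply: inNU.
have [-> // | /eqP a0] := eqVneq a [::].
have [_ +] := Pop _ _ (IHa a0) Prb.
by rewrite succ_vee ?star0r ?veeLU //; apply: inNU.
Qed.

(** * Extension of the axioms to () *)

(** Total versions of [precP] and [succP], with value 0 on the pair of two (). *)
Definition precE x y : V := bilin (@prec_e_b K) x y.
Definition succE x y : V := bilin (@succ_e_b K) x y.

(** The convention for () on the right agrees with the general formula, since [star] by () fixes the
    right subtree. *)
Lemma prec_e_b_nename u v : nename u -> prec_e_b K u v = prec_b K u v.
Proof.
move=> nu; rewrite /prec_e_b; case: eqP => [|_]; first by case: nu.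
case: eqP => // ->; have [a [b [na nb ->]]] := nenameE nu.
by rewrite prec_b_vee // star_b0r veeLU.
Qed.

Lemma succ_e_b_nename u v : nename v -> succ_e_b K u v = succ_b K u v.
Proof.
move=> nv; rewrite /succ_e_b; case: eqP => [|_]; first by case: nv.
case: eqP => // ->; have [c [d [nc nd ->]]] := nenameE nv.
by rewrite succ_b_vee // star_b0l veeLU.
Qed.

Lemma precE_inNstar x y : inNstar x -> precE x y = prec x y.
Proof.
move=> Nx; apply: (@eq_bilin nename xpredT) => // u v nu _.
exact: prec_e_b_nename.
Qed.

Lemma succE_inNstar x y : inNstar y -> succE x y = succ x y.
Proof.
move=> Ny; apply: (@eq_bilin xpredT nename) => // u v _ nv.
exact: succ_e_b_nename.
Qed.

Lemma precE_nil x : precE << [::] >> x = 0.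
Proof.
apply: (@eq_on_supported xpredT (precE << [::] >>) (fun=> 0)) => // [|k y z|v _].
- exact: bilinPr.
- by rewrite scaler0 addr0.
by rewrite /precE bilinU.
Qed.

Lemma succE_nil x : succE x << [::] >> = 0.
Proof.
apply: (@eq_on_supported xpredT (fun x => succE x << [::] >>) (fun=> 0))
  => // [|k y z|v _].
- exact: bilinPl.
- by rewrite scaler0 addr0.
by rewrite /succE bilinU.
Qed.

Lemma name_nil_or_nename v : is_name v -> v = [::] \/ nename v.
Proof. by move=> nv; case: (eqVneq v [::]) => [|/eqP]; [left | right]. Qed.

(** The leftmost factor decides: if it is (), both sides vanish; otherwise every product is an
    ordinary [prec]. *)
Lemma precE_precEA x y z : inN x -> inN y -> inN z ->
  precE (precE x y) z = precE x (star y z).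
Proof.
apply: bilin_assoc => u v w /name_nil_or_nename[-> | nu] nv nw.
  change (precE (precE << [::] >> << v >>) << w >> =
          precE << [::] >> (star << v >> << w >>) :> V).
  by rewrite !precE_nil; apply: (lin0 (bilinPl (@prec_e_b K) << w >>)).
change (precE (precE << u >> << v >>) << w >> =
        precE << u >> (star << v >> << w >>) :> V).
have [Nu [Mv Mw]] := (inNstarU nu, (inNU nv, inNU nw)).
have Nuv := inNstar_prec Nu Mv.
by rewrite !(precE_inNstar _ Nu) (precE_inNstar _ Nuv) (prec_precA Nu Mv Mw).
Qed.

(** Here the middle factor decides, and in the next axiom the rightmost one. *)
Lemma succE_precEA x y z : inN x -> inN y -> inN z ->
  precE (succE x y) z = succE x (precE y z).
Proof.
apply: bilin_assoc => u v w nu /name_nil_or_nename[-> | nv] nw.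
  change (precE (succE << u >> << [::] >>) << w >> =
          succE << u >> (precE << [::] >> << w >>) :> V).
  rewrite succE_nil precE_nil.
  rewrite [LHS](lin0 (bilinPl (@prec_e_b K) << w >>)).
  exact/esym/(lin0 (bilinPr (@succ_e_b K) << u >>)).
change (precE (succE << u >> << v >>) << w >> =
        succE << u >> (precE << v >> << w >>) :> V).
have [Nv [Mu Mw]] := (inNstarU nv, (inNU nu, inNU nw)).
have [Nuv Nvw] := (inNstar_succ Mu Nv, inNstar_prec Nv Mw).
rewrite (precE_inNstar _ Nv) (succE_inNstar _ Nv).
by rewrite (precE_inNstar _ Nuv) (succE_inNstar _ Nvw) (succ_precA Mu Nv Mw).
Qed.

Lemma succE_succEA x y z : inN x -> inN y -> inN z ->
  succE (star x y) z = succE x (succE y z).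
Proof.
apply: bilin_assoc => u v w nu nv /name_nil_or_nename[-> | nw].
  change (succE (star << u >> << v >>) << [::] >> =
          succE << u >> (succE << v >> << [::] >>) :> V).
  by rewrite !succE_nil; apply/esym/(lin0 (bilinPr (@succ_e_b K) << u >>)).
change (succE (star << u >> << v >>) << w >> =
        succE << u >> (succE << v >> << w >>) :> V).
have [Nw [Mu Mv]] := (inNstarU nw, (inNU nu, inNU nv)).
have Nvw := inNstar_succ Mv Nw.
by rewrite !(succE_inNstar _ Nw) (succE_inNstar _ Nvw) (succ_succA Mu Mv Nw).
Qed.

End Dendriform.

Theorem mainTheorem12 (K : fieldType) (charK0 : [pchar K] =i pred0) :
  (* (K \hat N^\infty_*, <, >) is a dendriform dialgebra ... *)
  dendriform_on (@inNstar K) (@prec K) (@succ K) /\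
  (* ... with < + > = \star ... *)
  (forall x y : V K, inNstar x -> inNstar y -> prec x y + succ x y = star x y) /\
  (* ... generated by (1) *)
  generated_by (@inNstar K) << [:: 1%N] >> (@prec K) (@succ K) /\
  (* on K \hat N^\infty the axioms hold whenever all terms are defined *)
  (forall x y z : V K, inN x -> inN y -> inN z ->
     [/\ eq_if_def (obind (fun a => precP a z) (precP x y)) (precP x (star y z)),
         eq_if_def (obind (fun a => precP a z) (succP x y))
                   (obind (fun b => succP x b) (precP y z)) &
         eq_if_def (succP (star x y) z) (obind (fun b => succP x b) (succP y z))]) /\
  (* () is a two-sided unit for \star *)
  (forall x : V K, inN x -> star x << [::] >> = x /\ star << [::] >> x = x).
Proof.
split; first exact: dendriform_inNstar.
split; first exact: prec_succ.
split; first exact: generated_inNstar.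
split=> [x y z Nx Ny Nz | x _]; last by rewrite star0r star0l.
(* An undefined term makes [eq_if_def] trivial; what remains are the identities for the total
   versions. *)
rewrite /precP /succP; split; do 2?case: ifP => //= _; do ?case: ifP => //= _.
- exact: precE_precEA.
- exact: succE_precEA.
- exact: succE_succEA.
Qed.
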